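(* Let $(V,+,\boxdot)$ be a near algebra with multiplicative identity $\mathbf{e}$. Suppose that $(\mathbf{x}_{st})_{0\le s<t}$ is a one-way flow in $V$. Then there exists a unique $\mathbf{h}\in V$ such that $\mathbf{e}+s\mathbf{h}$ is $\boxdot$-invertible for all $s\ge0$ and $$\mathbf{x}_{st}=(\mathbf{e}+s\mathbf{h})^{-1}\boxdot(\mathbf{e}+t\mathbf{h})\qquad\text{for all }0\le s<t.$$ Conversely, if $\mathbf{h}\in V$ is such that $\mathbf{e}+s\mathbf{h}$ is $\boxdot$-invertible for all $s\ge0$, then the family $(\mathbf{x}_{st})_{0\le s<t}$ given by this formula is a one-way flow.
   Context: A near algebra $(V,+,\boxdot)$ (here always with multiplicative identity) is a real linear space $(V,+)$ with an associative multiplication $\boxdot$ that is left-distributive, $\mathbf{x}\boxdot(\mathbf{y}+\mathbf{z})=\mathbf{x}\boxdot\mathbf{y}+\mathbf{x}\boxdot\mathbf{z}$, and left-homogeneous, $\mathbf{x}\boxdot(\lambda\mathbf{y})=\lambda(\mathbf{x}\boxdot\mathbf{y})$ for $\lambda\in\mathbb{R}$, and that has a two-sided neutral element $\mathbf{e}$. The inverse $\mathbf{x}^{-1}$ of $\mathbf{x}$, if it exists, is the unique element with $\mathbf{x}\boxdot\mathbf{x}^{-1}=\mathbf{x}^{-1}\boxdot\mathbf{x}=\mathbf{e}$. A family $(\mathbf{x}_{st})_{0\le s<t}$ of $\boxdot$-invertible elements of $V$ is a one-way flow (on $[0,\infty)$) in $V$ if $\mathbf{x}_{st}\boxdot\mathbf{x}_{tu}=\mathbf{x}_{su}$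 for all $0\le s<t<u$, and for all $0\le s<u$ the element $\frac{1}{u-s}(\mathbf{x}_{su}-\mathbf{e})$ does not depend on $u$. *)

(* Defs.v *)
From HB Require Import structures.
From mathcomp Require Import all_boot all_order all_algebra.
From mathcomp Require Import boolp classical_sets reals.

Set Implicit Arguments.
Unset Strict Implicit.
Unset Printing Implicit Defensive.

Import Order.TTheory GRing.Theory Num.Theory.
Local Open Scope ring_scope.

(* The linear structure is written in ring_scope and the multiplication in
   group_scope: x \boxdot y is (x * y)%g and e is 1%g.  Only the left laws are
   required, so 0 * x, (y + z) * x and (a *: y) * x need not simplify.  The
   zero space is allowed. *)
HB.mixin Record Lmodule_Monoid_isNearAlgebra (R : pzRingType) V
    of GRing.Lmodule R V & monoid.Monoid V := {
  nearmulDr : forall x y z : V, (x * (y + z)%R)%g = (x * y)%g + (x * z)%g;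
  nearmulZr : forall (x : V) (a : R) (y : V), (x * (a *: y)%R)%g = a *: (x * y)%g
}.

#[short(type="nearAlgType")]
HB.structure Definition NearAlgebra (R : pzRingType) :=
  {V of Lmodule_Monoid_isNearAlgebra R V & GRing.Lmodule R V & monoid.Monoid V}.

Section NearAlgebraDefs.
Variables (R : realType) (V : nearAlgType R).
Implicit Types x y : V.

Definition is_inverse x y : Prop := (x * y)%g = 1%g /\ (y * x)%g = 1%g.

Definition invertible x : Prop := exists y, is_inverse x y.

(* The inverse of x; the value is e when x is not invertible. *)
Definition nearinv x : V := xget 1%g [set y | is_inverse x y]%classic.

(* A family indexed by 0 <= s < t is encoded as a function of all pairs of
   reals; its values at other pairs are irrelevant. *)
Definition one_way_flow (X : R -> R -> V) : Prop :=
  [/\ forall s t, 0 <= s -> s < t -> invertible (X s t),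
      forall s t u, 0 <= s -> s < t -> t < u -> (X s t * X t u)%g = X s u
    & forall s u u', 0 <= s -> s < u -> s < u' ->
        (u - s)^-1 *: (X s u - 1%g) = (u' - s)^-1 *: (X s u' - 1%g)].

End NearAlgebraDefs.

(* Main.v *)
Require Import Defs.
From HB Require Import structures.
From mathcomp Require Import all_boot all_order all_algebra.
From mathcomp Require Import boolp classical_sets reals.
Set Implicit Arguments.
Unset Strict Implicit.
Unset Printing Implicit Defensive.
Import Order.TTheory GRing.Theory Num.Theory.
Local Open Scope ring_scope.

(** At base point 0 the slope condition makes the flow affine: comparing the endpoints t and 1 gives
    x_{0t} = e + t h with h = x_{01} - e ([one_way_flow_from0]). So e + t h is invertible, and
    cancelling x_{0s} on the left of x_{0s} x_{st} = x_{0t} gives the formula. Conversely, the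
    inverse stands on the left, so the left laws suffice to compute (e + s h)^{-1} (e + u h) - e =
    (u - s) (e + s h)^{-1} h, whose slope is free of u; composition is a cancellation of the middle
    factors. *)

Section NearAlgebraInverse.
Variables (R : realType) (V : nearAlgType R).
Implicit Types x y z : V.

Lemma nearmulBr x y z : (x * (y - z)%R)%g = (x * y)%g - (x * z)%g.
Proof. by rewrite -scaleN1r nearmulDr nearmulZr scaleN1r. Qed.

Lemma invertible1 : invertible (1%g : V).
Proof. by exists 1%g; split; rewrite mulg1. Qed.

Lemma nearinvP x : invertible x -> is_inverse x (nearinv x).
Proof. by move=> [y xy]; apply: (@xgetPex V 1%g [set y | is_inverse x y]%classic); exists y. Qed.

Lemma nearmulxV x : invertible x -> (x * nearinv x)%g = 1%g.
Proof. by case/nearinvP. Qed.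

Lemma nearmulVx x : invertible x -> (nearinv x * x)%g = 1%g.
Proof. by case/nearinvP. Qed.

Lemma nearmulVKx x y : invertible x -> (nearinv x * (x * y))%g = y.
Proof. by move=> x_inv; rewrite mulgA nearmulVx // mul1g. Qed.

Lemma nearmulxVK x y : invertible x -> (x * (nearinv x * y))%g = y.
Proof. by move=> x_inv; rewrite mulgA nearmulxV // mul1g. Qed.

Lemma nearinv1 : nearinv (1%g : V) = 1%g.
Proof. by rewrite -[LHS]mul1g nearmulxV //; exact: invertible1. Qed.

Lemma invertible_Vmul x y :
  invertible x -> invertible y -> invertible (nearinv x * y)%g.
Proof.
move=> x_inv y_inv; exists (nearinv y * x)%g.
by split; rewrite -mulgA nearmulxVK ?nearmulVx.
Qed.

End NearAlgebraInverse.

Lemma one_way_flow_from0 (R : realType) (V : nearAlgType R) (X : R -> R -> V) :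
  one_way_flow X -> forall t, 0 < t -> X 0 t = 1%g + t *: (X 0 1 - 1%g).
Proof.
move=> [_ _ slope] t t_gt0.
have := slope 0 t 1 (lexx 0) t_gt0 ltr01.
rewrite !subr0 invr1 scale1r => <-.
by rewrite scalerA divff ?gt_eqF // scale1r addrC subrK.
Qed.

Theorem theorem2p3 (R : realType) (V : nearAlgType R) :
  (forall X : R -> R -> V, one_way_flow X ->
     exists! h : V,
       (forall s : R, 0 <= s -> invertible (1%g + s *: h)) /\
       (forall s t : R, 0 <= s -> s < t ->
          X s t = (nearinv (1%g + s *: h) * (1%g + t *: h)%R)%g)) /\
  (forall h : V,
     (forall s : R, 0 <= s -> invertible (1%g + s *: h)) ->
     one_way_flow
       (fun s t : R => (nearinv (1%g + s *: h) * (1%g + t *: h)%R)%g)).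
Proof.
split=> [X X_flow | h h_inv].
  have X0E := one_way_flow_from0 X_flow.
  have [X_inv X_comp _] := X_flow.
  (* The case s = 0 is separate because the flow says nothing about [X 0 0]; there the element is e
     itself. *)
  have lin_inv s : 0 <= s -> invertible (1%g + s *: (X 0 1 - 1%g)).
    rewrite le_eqVlt => /predU1P[<-|s_gt0].
      by rewrite scale0r addr0; exact: invertible1.
    by rewrite -X0E //; exact: X_inv.
  exists (X 0 1 - 1%g); split.
    split=> // s t; rewrite le_eqVlt => /predU1P[<- t_gt0|s_gt0 lt_st].
      by rewrite scale0r addr0 nearinv1 mul1g; exact: X0E.
    have t_gt0 := lt_trans s_gt0 lt_st.
    (* Both affine factors become [X 0 s] and [X 0 t]; splitting the latter at s lets [X 0 s]
       cancel. *)
    by rewrite -!X0E // -(X_comp 0 s t) // nearmulVKx //; exact: X_inv.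
  (* Uniqueness: the formula for k at s = 0, t = 1 reads x_{01} = e + k. *)
  move=> k [_ /(_ 0 1 (lexx 0) ltr01) ->].
  by rewrite scale0r addr0 nearinv1 mul1g scale1r addrC addKr.
split=> [s t s_ge0 lt_st | s t u s_ge0 lt_st _ | s u u' s_ge0 lt_su lt_su'].
- by apply: invertible_Vmul; apply: h_inv => //; exact: ltW (le_lt_trans s_ge0 lt_st).
- rewrite -mulgA nearmulxVK //.
  by apply: h_inv; exact: ltW (le_lt_trans s_ge0 lt_st).
(* The common value of the slopes from s, with v absent from the right-hand side. *)
have slope v : s < v ->
    (v - s)^-1 *: ((nearinv (1%g + s *: h) * (1%g + v *: h)%R)%g - 1%g) =
    (nearinv (1%g + s *: h) * h)%g.
  (* Writing the subtracted e as (e + s h)^{-1} (e + s h) gives both terms the same left factor,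
     which left distributivity pulls out. *)
  move=> lt_sv; rewrite -[X in _ *: (_ - X)](nearmulVx (h_inv s s_ge0)).
  rewrite -nearmulBr opprD addrACA subrr add0r -scalerBl nearmulZr scalerA.
  by rewrite mulVf ?scale1r // subr_eq0 gt_eqF.
by rewrite !slope.
Qed.
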